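(* Let $(X_n)$ be a sequence of finite sets and let $(\mathcal{F}_n)$ be a sequence of nontrivial upper sets $\mathcal{F}_n \subseteq 2^{X_n}$. Then the Kahn-Kalai bounds provide asymptotically perfect information for $(\mathcal{F}_n)$ if and only if $\log \ell(\mathcal{F}_n) \ll \frac{1}{q(\mathcal{F}_n)}$.
   Context: For a finite set $X$, an upper set is a subset $\mathcal{F}\subseteq 2^X$ such that $A\in\mathcal{F}$ and $A\subseteq B\subseteq X$ imply $B\in\mathcal{F}$; it is nontrivial if $\mathcal{F}\neq\emptyset$ and $\mathcal{F}\neq 2^X$. For $p\in[0,1]$ let $\mu_p(\mathcal{F})=\sum_{S\in\mathcal{F}}p^{|S|}(1-p)^{|X|-|S|}$; for nontrivial $\mathcal{F}$, the critical probability $p_c(\mathcal{F})$ is the unique $p\in[0,1]$ with $\mu_p(\mathcal{F})=\frac12$. For $S\subseteq X$ let $\langle S\rangle=\{T\subseteq X: S\subseteq T\}$. A set $\mathcal{G}\subseteq 2^X$ is a cover of $\mathcal{F}$ if $\mathcal{F}\subseteq\bigcup_{S\in\mathcal{G}}\langle S\rangle$. $\mathcal{F}$ is $p$-small if it has a cover $\mathcal{G}$ with $\sum_{S\in\mathcal{G}}p^{|S|}\leq\frac12$. The expectation threshold $q(\mathcal{F})$ is the largest $p\in[0,1]$ for which $\mathcal{F}$ is $p$-small. $\mathcal{F}_0$ denotes the set of (inclusion-)minimal elements of an upper set $\mathcal{F}$, $\ell_0(\mathcal{F})=\max\{|S|:S\in\mathcal{F}_0\}$ and $\ell(\mathcal{F})=\max\{\ell_0(\mathcal{F}),2\}$.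 $\log$ is the logarithm to base 2. The Kahn-Kalai bounds are $q(\mathcal{F}_n)\leq p_c(\mathcal{F}_n)\leq Kq(\mathcal{F}_n)\log\ell(\mathcal{F}_n)$, where $K$ is any universal constant for which these inequalities hold for all members of all sequences in a specified class of sequences of nontrivial upper sets to which $(\mathcal{F}_n)$ belongs. They provide asymptotically perfect information for $(\mathcal{F}_n)$ when the width of the resulting interval containing $p_c(\mathcal{F}_n)$ shrinks to zero, i.e. $\lim_{n\to\infty}\big(K\log\ell(\mathcal{F}_n)-1\big)q(\mathcal{F}_n)=0$. For positive sequences, $a_n\ll b_n$ means $a_n/b_n\to 0$ as $n\to\infty$. *)

(* Defs.v *)
From HB Require Import structures.
From mathcomp Require Import all_boot all_order all_algebra.
From mathcomp Require Import all_classical all_reals all_analysis.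

Set Implicit Arguments.
Unset Strict Implicit.
Unset Printing Implicit Defensive.

Import Order.TTheory GRing.Theory Num.Theory.
Import numFieldNormedType.Exports.

Local Open Scope classical_set_scope.
Local Open Scope ring_scope.

Definition upper_set (X : finType) (F : {set {set X}}) : Prop :=
  forall A B : {set X}, A \in F -> A \subset B -> B \in F.

(* A finite set X bundled with a nontrivial upper set on it. *)
Record nontrivial_upper_set := NontrivialUpperSet {
  ground : finType;
  family :> {set {set ground}};
  familyP : upper_set family;
  family_neq0 : family != finset.set0;
  family_neqT : family != finset.setT }.

Section Thresholds.
Variables (R : realType) (X : finType).
Implicit Types (F G : {set {set X}}) (p : R).

Definition mu p F : R :=
  \sum_(S in F) p ^+ #|S| * (1 - p) ^+ (#|X| - #|S|).

(* The p in [0,1] with mu p F = 1/2 is unique when F is a nontrivial upper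
   set; the default value 0 of xget is then irrelevant. *)
Definition critical_probability F : R :=
  xget 0 [set p : R | (0 <= p <= 1) /\ mu p F = 2^-1].

Definition cover F G : Prop :=
  forall T : {set X}, T \in F -> exists2 S, S \in G & S \subset T.

Definition p_small p F : Prop :=
  exists G, cover F G /\ \sum_(S in G) p ^+ #|S| <= 2^-1.

(* The largest p in [0,1] for which F is p-small. It exists when F is a
   nontrivial upper set: F is then 0-small, and each of the finitely many
   covers gives a closed condition on p. *)
Definition expectation_threshold F : R :=
  let small := [set p : R | (0 <= p <= 1) /\ p_small p F] in
  xget 0 [set p | small p /\ ubound small p].

End Thresholds.

Definition ell0 (X : finType) (F : {set {set X}}) : nat :=
  \max_(S : {set X} | minset (fun T => T \in F) S) #|S|.

Definition ell (X : finType) (F : {set {set X}}) : nat := maxn (ell0 F) 2.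

Definition log2 (R : realType) (x : R) : R := ln x / ln 2.

Definition much_less (R : realType) (a b : nat -> R) : Prop :=
  (fun n => a n / b n) @ \oo --> (0 : R).

Section KahnKalai.
Variable R : realType.
Implicit Types (K : R) (C : (nat -> nontrivial_upper_set) -> Prop).
Implicit Type F : nat -> nontrivial_upper_set.

Definition kahn_kalai_constant C K : Prop :=
  forall F, C F -> forall n,
    expectation_threshold R (F n) <= critical_probability R (F n) /\
    critical_probability R (F n) <=
      K * expectation_threshold R (F n) * log2 (ell (F n))%:R.

Definition width_vanishes K F : Prop :=
  (fun n => (K * log2 (ell (F n))%:R - 1) * expectation_threshold R (F n))
    @ \oo --> (0 : R).

(* K is any constant valid for the specified class C. Quantifying over all
   such K matters when C is so small that the best K is at most 1: if C consists
   of the constant sequence of the family generated by one singleton, then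
   q = p_c = 1/2, ell = 2 and K = 1 is valid, with an interval of width 0,
   although log ell << 1/q fails. *)
Definition perfect_information C F : Prop :=
  forall K, kahn_kalai_constant C K -> width_vanishes K F.

End KahnKalai.

(* Main.v *)
(* The width is [(K L - 1) q] with [L = log ell >= 1] and [0 <= q], so that
   [(K - 1) L q <= (K L - 1) q = K L q - q] and [q <= L q]: for [K > 1] the width vanishes if and
   only if [L q] does. An admissible [K] can always be enlarged, and an
   admissible [K] for the class of all sequences exceeds [1], because the
   nonempty subsets of a two-point set have [ell = 2], [q <= 1/4] and
   [p_c = 1 - 1/sqrt 2 > 1/4]. *)

Require Import Defs.
From HB Require Import structures.
From mathcomp Require Import all_boot all_order all_algebra.
From mathcomp Require Import all_classical all_reals all_analysis.
From mathcomp Require Import ring lra.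

Set Implicit Arguments.
Unset Strict Implicit.
Unset Printing Implicit Defensive.

Import Order.TTheory GRing.Theory Num.Theory.
Import numFieldNormedType.Exports.

Local Open Scope classical_set_scope.
Local Open Scope ring_scope.

Section Bounds.
Variable R : realType.
Implicit Types (K : R) (F : nat -> nontrivial_upper_set).

Lemma log2_2 : log2 2 = 1 :> R.
Proof. by rewrite /log2 divff// gt_eqF// ln_gt0// ltr1n. Qed.

Lemma log2_ell_ge1 (X : finType) (F : {set {set X}}) :
  1 <= log2 (ell F)%:R :> R.
Proof.
rewrite -[leLHS]log2_2 /log2 ler_pM2r ?invr_gt0 ?ln_gt0 ?ltr1n//.
have le2 : (2 <= ell F)%N by exact: leq_maxr.
by rewrite ler_ln ?posrE ?ltr0n ?ler_nat//; exact: ltnW.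
Qed.

Lemma expectation_threshold_ge0 (X : finType) (F : {set {set X}}) :
  0 <= expectation_threshold R F.
(* The default value of [xget] is 0, so its second case satisfies the bound as well. *)
Proof. by rewrite /expectation_threshold; case: xgetP => // p _ [[/andP[]]]. Qed.

Lemma kahn_kalai_constantW C K K' :
  K <= K' -> kahn_kalai_constant C K -> kahn_kalai_constant C K'.
Proof.
move=> leK hK F CF n; have [lo up] := hK F CF n; split=> //.
apply: le_trans up _; rewrite ler_wpM2r ?(le_trans ler01) ?log2_ell_ge1//.
by rewrite ler_wpM2r// expectation_threshold_ge0.
Qed.

(** Inversion is an involution that fixes 0, so the quotient equals the product even at indices
    where [b n = 0]. *)
Lemma much_less_inv (a b : nat -> R) :
  much_less a (fun n => 1 / b n) <-> (fun n => a n * b n) @ \oo --> (0 : R).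
Proof.
by rewrite /much_less; under eq_fun do rewrite div1r invrK.
Qed.

Lemma sparse_width_vanishes K F :
  (fun n => log2 (ell (F n))%:R * expectation_threshold R (F n))
    @ \oo --> (0 : R) -> width_vanishes K F.
Proof.
move=> Lq0; have q0 : (fun n => expectation_threshold R (F n)) @ \oo --> (0 : R).
  apply: (squeeze_cvgr _ (cvg_cst 0) Lq0); apply: nearW => n.
  by rewrite expectation_threshold_ge0 ler_peMl ?expectation_threshold_ge0
             ?log2_ell_ge1.
rewrite /width_vanishes; under eq_fun do rewrite mulrBl mul1r -mulrA.
have -> : 0 = K * 0 - 0 by rewrite mulr0 subr0.
by apply: cvgB => //; exact: cvgM (cvg_cst K) Lq0.
Qed.

Lemma width_vanishes_sparse K F : 1 < K -> width_vanishes K F ->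
  (fun n => log2 (ell (F n))%:R * expectation_threshold R (F n))
    @ \oo --> (0 : R).
Proof.
move=> K1 w0; have K10 : 0 < K - 1 by rewrite subr_gt0.
have w0' : (fun n => (K - 1)^-1 *
    ((K * log2 (ell (F n))%:R - 1) * expectation_threshold R (F n)))
    @ \oo --> (0 : R).
  by rewrite -(mulr0 (K - 1)^-1); exact: cvgM (cvg_cst _) w0.
apply: (squeeze_cvgr _ (cvg_cst 0) w0'); apply: nearW => n.
have L1 := log2_ell_ge1 (F n); have q0 := expectation_threshold_ge0 (F n).
rewrite mulr_ge0 ?(le_trans ler01 L1)//= ler_pdivlMl// mulrA ler_wpM2r//.
(* What remains is [K L - L <= K L - 1], that is [1 <= L]. *)
by rewrite mulrBl mul1r lerB.
Qed.

End Bounds.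

Section NonemptySubsetsOfBool.
Local Open Scope set_scope.

(** Listing the members lets sums over the family be split term by term. *)
Definition nonempty_bool : {set {set bool}} :=
  [set [set true]; [set false]; [set: bool]].

Lemma in_nonempty_bool (S : {set bool}) :
  (S \in nonempty_bool) = (S != finset.set0).
Proof.
have boolsetE (A B : {set bool}) :
    (A == B) = ((true \in A) == (true \in B)) && ((false \in A) == (false \in B)).
  apply/eqP/andP => [->|[/eqP At /eqP Af]]; first by rewrite !eqxx.
  by apply/setP => -[].
by rewrite !inE !boolsetE !inE; case: (true \in S); case: (false \in S).
Qed.

Lemma nonempty_bool_upper : upper_set nonempty_bool.
Proof.
move=> A B; rewrite !in_nonempty_bool => A0 AB.
by apply: contraNneq A0 => B0; rewrite B0 finset.subset0 in AB.
Qed.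

Lemma nonempty_bool_neq0 : nonempty_bool != finset.set0.
Proof.
by apply/set0Pn; exists finset.setT; rewrite !inE eqxx !orbT.
Qed.

Lemma nonempty_bool_neqT : nonempty_bool != finset.setT.
Proof.
apply/eqP => /setP/(_ finset.set0).
by rewrite in_nonempty_bool eqxx finset.inE.
Qed.

Definition nonempty_bool_family :=
  NontrivialUpperSet nonempty_bool_upper nonempty_bool_neq0 nonempty_bool_neqT.

Lemma ell_nonempty_bool : ell nonempty_bool = 2%N.
Proof.
apply/maxn_idPr/bigmax_leqP => S _.
by rewrite -card_bool max_card.
Qed.

Variable R : realType.

Lemma mu_nonempty_bool (p : R) : mu p nonempty_bool = 1 - (1 - p) ^+ 2.
Proof.
have neq_tf : [set true] != [set false] :> {set bool}.
  by apply/eqP => /setP/(_ true); rewrite !inE.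
have neqT (b : bool) : [set b] != finset.setT :> {set bool}.
  by apply/eqP => /setP/(_ (~~ b)); rewrite !inE; case: b.
rewrite /mu /nonempty_bool -finset.setUA big_setU1; last first.
  by rewrite !inE negb_or neq_tf neqT.
rewrite big_setU1 ?inE ?neqT//= big_set1 !cards1 cardsT card_bool.
(* The singletons contribute [p (1 - p)] each and the full set [p ^+ 2]. *)
by rewrite subnn subn1 /=; ring.
Qed.

Lemma critical_probability_nonempty_bool :
  4^-1 < critical_probability R nonempty_bool.
Proof.
set s : R := Num.sqrt 2^-1.
have s2 : s ^+ 2 = 2^-1 by rewrite sqr_sqrtr// invr_ge0.
have s0 : 0 <= s by exact: sqrtr_ge0.
have [[/andP[p0 p1]]] : [set p : R | (0 <= p <= 1) /\ mu p nonempty_bool = 2^-1]%classic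
    (critical_probability R nonempty_bool).
  (* The root [1 - s] shows that [xget] returns a true solution and not its default. *)
  apply: (xgetPex (0 : R)); exists (1 - s); split; last first.
    by rewrite mu_nonempty_bool; lra.
  apply/andP; split; nra.
(* If [p <= 1/4], then [(1 - p) ^+ 2 >= 9/16 > 1/2], which contradicts [mu = 1/2]. *)
by rewrite mu_nonempty_bool; nra.
Qed.

(** The empty set alone would cost [p ^+ 0 = 1 > 1/2], so it is not in the cover. Each singleton
    must then be covered by itself, and the two together cost [2 p <= 1/2]. *)
Lemma p_small_nonempty_bool (p : R) : 0 <= p ->
  p_small p nonempty_bool -> p <= 4^-1.
Proof.
move=> p0 [G [covG sumG]].
have G0 : finset.set0 \notin G.
  apply: contraTN sumG => G0; rewrite -ltNge (bigD1 finset.set0)//= cards0 expr0.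
  have : 0 <= \sum_(S in G | S != finset.set0) p ^+ #|S|.
    by apply: sumr_ge0 => S _; exact: exprn_ge0.
  lra.
have Gb (b : bool) : [set b] \in G.
  have [|S SG] := covG [set b]; first by rewrite !inE; case: b; rewrite eqxx ?orbT.
  by rewrite finset.subset1 => /orP[/eqP<-//|/eqP S0]; rewrite -S0 SG in G0.
move: sumG; rewrite (bigD1 [set true])//= (bigD1 [set false])/=; last first.
  by rewrite Gb; apply/eqP => /setP/(_ true); rewrite !inE.
rewrite !cards1 !expr1.
set rest := \sum_(S | _) _.
have : 0 <= rest by apply: sumr_ge0 => S _; exact: exprn_ge0.
lra.
Qed.

Lemma expectation_threshold_nonempty_bool :
  expectation_threshold R nonempty_bool <= 4^-1.
Proof.
rewrite /expectation_threshold; case: xgetP => [p _ [[/andP[p0 _]]]|_].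
  by move=> /(p_small_nonempty_bool p0).
by rewrite invr_ge0.
Qed.

(** The logarithmic factor is 1 here, so [1/4 < p_c <= K q] with [0 <= q <= 1/4], which is
    impossible for [K <= 1]. *)
Lemma kahn_kalai_constant_gt1 (C : (nat -> nontrivial_upper_set) -> Prop) (K : R) :
  C (fun=> nonempty_bool_family) -> kahn_kalai_constant C K -> 1 < K.
Proof.
move=> C0 /(_ _ C0 0%N)[_] /=; rewrite ell_nonempty_bool log2_2 mulr1.
have := critical_probability_nonempty_bool.
have := expectation_threshold_nonempty_bool.
have := expectation_threshold_ge0 R nonempty_bool.
by nra.
Qed.

End NonemptySubsetsOfBool.

Theorem theorem3p1 (R : realType)
    (C : (nat -> nontrivial_upper_set) -> Prop) (K : R)
    (hK : kahn_kalai_constant C K)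
    (F : nat -> nontrivial_upper_set) (hF : C F) :
  let sparse := much_less (fun n => log2 (ell (F n))%:R)
                          (fun n => 1 / expectation_threshold R (F n)) in
  (perfect_information R C F <-> sparse) /\
  (1 < K \/ (forall G, C G) -> (width_vanishes K F <-> sparse)).
Proof.
move=> sparse; rewrite /sparse !much_less_inv; split; last first.
  move=> K1; split; last exact: sparse_width_vanishes.
  apply: width_vanishes_sparse; case: K1 => // allC.
  exact: kahn_kalai_constant_gt1 (allC _) hK.
split=> [info|Lq0 K' _]; last exact: sparse_width_vanishes.
(* The given [K] may be at most 1. Its enlargement to [Num.max K 2] exceeds 1 and is still valid for
   [C], so [info] applies to it. *)
apply: (@width_vanishes_sparse _ (Num.max K 2)).
  by rewrite lt_max ltr1n orbT.
by apply/info/(kahn_kalai_constantW _ hK); rewrite le_max lexx.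
Qed.
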